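(* Let $Q,T_1,T_2,X\in\mathcal{B}(\mathcal{H})$ be such that $T_1$, $T_2$ and $QT_2$ are contractions and $T_1X=XQT_2$. Let $V_1\in\mathcal{B}(\mathcal{K}_1)$ and $V_2\in\mathcal{B}(\mathcal{K}_2)$ be any co-isometric extensions of $T_1$ and $T_2$ respectively, where $\mathcal{K}_1,\mathcal{K}_2\supseteq\mathcal{H}$. Let $\overline{Q}\in\mathcal{B}(\mathcal{K}_2)$ be any extension of $Q$ such that $\overline{Q}V_2$ is a contraction. Then there is a norm preserving extension $Y:\mathcal{K}_2\to\mathcal{K}_1$ of $X$ such that $V_1Y=Y\overline{Q}V_2$.
   Context: All Hilbert spaces are complex; $\mathcal{B}(\mathcal{H})$ is the algebra of bounded linear operators on $\mathcal{H}$; containment of Hilbert spaces means containment as a closed linear subspace; a contraction is an operator of norm at most one. For $\mathcal{H}\subseteq\mathcal{K}$, $B\in\mathcal{B}(\mathcal{K})$ is an extension of $A\in\mathcal{B}(\mathcal{H})$ if $Bh=Ah$ for all $h\in\mathcal{H}$ (so $\mathcal{H}$ is invariant under $B$); it is a co-isometric extension if in addition $BB^*=I_{\mathcal{K}}$. Similarly $Y\in\mathcal{B}(\mathcal{K}_2,\mathcal{K}_1)$ is an extension of $X\in\mathcal{B}(\mathcal{H})$ if $Yh=Xh$ for all $h\in\mathcal{H}$, where $\mathcal{H}$ is regarded as a subspace of both $\mathcal{K}_2$ and $\mathcal{K}_1$; it is norm preserving if $\|Y\|=\|X\|$. *)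

(* Defs.v *)
From HB Require Import structures.
From mathcomp Require Import all_boot all_order all_algebra.
From mathcomp Require Import complex.
From mathcomp Require Import boolp classical_sets reals.
From mathcomp Require Import topology normedtype.
Set Implicit Arguments.
Unset Strict Implicit.
Unset Printing Implicit Defensive.
Import Order.TTheory GRing.Theory Num.Theory.
Import numFieldNormedType.Exports.

Local Open Scope classical_set_scope.
Local Open Scope ring_scope.

(* A complex Hilbert space: a complete normed space over R[i] whose norm comes
   from an inner product, linear in its first argument and conjugate-linear in
   its second. *)
HB.mixin Record CompleteNormedModule_isHilbert (R : realType) H
    of CompleteNormedModule R[i] H := {
  inner : {dot H for (@Num.conj R[i])};
  normr_inner : forall x : H, `|x| ^+ 2 = inner x x
}.

#[short(type="hilbertType")]
HB.structure Definition Hilbert (R : realType) :=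
  {H of CompleteNormedModule R[i] H & CompleteNormedModule_isHilbert R H}.

HB.mixin Record isBoundedLinear (K : numFieldType) (U V : normedModType K)
    (f : U -> V) := {
  bounded_linear_subproof : bounded_near f (nbhs (0 : U))
}.

#[short(type="boundedLinear")]
HB.structure Definition BoundedLinear (K : numFieldType)
    (U V : normedModType K) :=
  {f of isBoundedLinear K U V f & @GRing.Linear K U V *:%R f}.

Notation "{ 'bounded' U -> V }" := (@BoundedLinear.type _ U%type V%type)
  (at level 0, U at level 98, V at level 99,
   format "{ 'bounded'  U  ->  V }") : type_scope.

Section Operators.
Context {R : realType}.

(* Norms over R[i] take their values in R[i], hence Re.  The supremum is
   meaningful when f is bounded on the unit ball. *)
Definition opnorm (U V : normedModType R[i]) (f : U -> V) : R :=
  sup [set complex.Re `|f x| | x in [set x : U | `|x| <= 1]].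

Definition contractive (U V : normedModType R[i]) (f : U -> V) : Prop :=
  opnorm f <= 1.

Definition is_adjoint (U V : hilbertType R) (A : {bounded U -> V})
    (B : {bounded V -> U}) : Prop :=
  forall (u : U) (v : V), inner (A u) v = inner u (B v).

Definition co_isometry (U V : hilbertType R) (A : {bounded U -> V}) : Prop :=
  exists2 B : {bounded V -> U}, is_adjoint A B & A \o B =1 id.

(* A containment of H in K is given by an inclusion map preserving linear
   structure and inner products; as H is complete, its image is closed. *)
Definition is_inclusion (H K : hilbertType R) (i : {linear H -> K}) : Prop :=
  isometry (@inner R K) (@inner R H) i.

(* B : K -> L extends A : H -> H, where H is contained in K via i and in L
   via j. *)
Definition is_extension (H K L : hilbertType R) (i : H -> K) (j : H -> L)
    (A : H -> H) (B : K -> L) : Prop :=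
  forall h : H, B (i h) = j (A h).

Definition co_isometric_extension (H K : hilbertType R) (i : H -> K)
    (A : {bounded H -> H}) (B : {bounded K -> K}) : Prop :=
  is_extension i i A B /\ co_isometry B.

Definition norm_preserving_extension (H K L : hilbertType R)
    (i : H -> K) (j : H -> L) (A : {bounded H -> H}) (B : {bounded K -> L}) :
    Prop :=
  is_extension i j A B /\ opnorm B = opnorm A.

End Operators.

(* Main.v *)
Require Import Defs.
From HB Require Import structures.
From mathcomp Require Import all_boot all_order all_algebra.
From mathcomp Require Import complex.
From mathcomp Require Import ring.
From mathcomp Require Import boolp classical_sets filter reals topology.
From mathcomp Require Import normedtype sequences.

(** Put W := Qbar V2, a contraction of K2 that maps H to itself and restricts
    to Q T2 there, and let c be the norm of X.  Seen as a map from H to K1, X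
    satisfies V1 X = X W, and the task is to extend it to K2 without increasing
    the norm or losing this relation.  Such a Y is a fixed point, found by
    averaging.

    Consider the maps Y from K2 to K1 that extend X and have norm at most c.
    Given such a Y, there is another one, Y', with V1 Y' = Y W: both
    prescriptions, Y' on H and V1 Y' on K2, have norm at most c, and they agree
    on H, so they can be completed simultaneously because V1 is a co-isometry
    ([contractive_completion]).  Iterating gives a sequence Y_n with
    V1 Y_(n+1) = Y_n W.  A Banach limit L, being shift invariant
    ([complex_banach_limit]), turns the forms <Y_n x, y> into one form
    L_n <Y_n x, y>, bounded by c, whose operator Y ([form_operator]) satisfies
    V1 Y = Y W and still extends X ([intertwining_lifting]).

    Both the completion and the passage from a form to its operator are
    instances of one fact, [extend_contraction]: a linear map into a complete
    space that is contractive for a semi-inner product extends contractively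
    from a subspace to the whole space.  As a semi-inner product may be
    degenerate and incomplete, defect forms such as c^2 <x, y> - <Bx, By>
    qualify directly, and their operator square roots do not come in. *)

Set Implicit Arguments.
Unset Strict Implicit.
Unset Printing Implicit Defensive.
Import Order.TTheory GRing.Theory Num.Theory.
Import numFieldNormedType.Exports.

Local Open Scope classical_set_scope.
Local Open Scope ring_scope.

(** * Semi-inner products *)

Section SemiInner.
Context {R : realType}.
Local Notation C := R[i].

Record semi_inner (E : lmodType C) (q : E -> E -> C) : Prop := {
  semi_innerP : forall a x y z, q (a *: x + y) z = a * q x z + q y z;
  semi_innerC : forall x y, q x y = (q y x)^*;
  semi_inner_ge0 : forall x, 0 <= q x x }.

Definition seminorm (E : lmodType C) (q : E -> E -> C) (x : E) : C :=
  sqrtC (q x x).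

Section Theory.
Variables (E : lmodType C) (q : E -> E -> C).
Hypothesis qP : semi_inner q.
Local Notation p := (seminorm q).

Lemma semi_innerDl x y z : q (x + y) z = q x z + q y z.
Proof. by have := semi_innerP qP 1 x y z; rewrite scale1r mul1r. Qed.

Lemma semi_inner0l z : q 0 z = 0.
Proof. by apply: (addrI (q 0 z)); rewrite -semi_innerDl !addr0. Qed.

Lemma semi_innerZl a x z : q (a *: x) z = a * q x z.
Proof. by have := semi_innerP qP a x 0 z; rewrite addr0 semi_inner0l addr0. Qed.

Lemma semi_innerBl x y z : q (x - y) z = q x z - q y z.
Proof. by rewrite -scaleN1r semi_innerDl semi_innerZl mulN1r. Qed.

Lemma semi_innerZr a x y : q x (a *: y) = a^* * q x y.
Proof. by rewrite !(semi_innerC qP x) semi_innerZl rmorphM. Qed.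

Lemma semi_innerBr x y z : q x (y - z) = q x y - q x z.
Proof. by rewrite 3!(semi_innerC qP x) semi_innerBl rmorphB. Qed.

Lemma seminorm_ge0 x : 0 <= p x.
Proof. by rewrite sqrtC_ge0 (semi_inner_ge0 qP). Qed.

Lemma sqr_seminorm x : p x ^+ 2 = q x x.
Proof. by rewrite sqrtCK. Qed.

Lemma semi_inner_sqrB u v t :
  q (u - t *: v) (u - t *: v) =
  q u u - (t^* * q u v + (t^* * q u v)^*) + `|t| ^+ 2 * q v v.
Proof.
rewrite semi_innerBl !semi_innerBr !semi_innerZl !semi_innerZr.
rewrite rmorphM/= conjCK -(semi_innerC qP) normCK.
ring.
Qed.

(** Minimizing the quadratic function of t on the right bounds its derivative at
    t = 0.  With d = 0 this says that a nearest point has an orthogonal residue;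
    the tolerance d makes it applicable where no nearest point exists, and
    d = q u u gives the Cauchy-Schwarz inequality. *)
Lemma near_minimal_orthogonal u v d : 0 <= d ->
  (forall t, q u u - d <= q (u - t *: v) (u - t *: v)) ->
  `|q u v| ^+ 2 <= d * q v v.
Proof.
move=> d0 min.
set a := q u v in min *.
have key s : s \is Num.real ->
    2 * s * `|a| ^+ 2 <= d + s ^+ 2 * `|a| ^+ 2 * q v v.
  move=> sR; have := min (s * a).
  rewrite semi_inner_sqrB -/a lerBlDr => le.
  have : 0 <= d - (2 * s * `|a| ^+ 2) + s ^+ 2 * `|a| ^+ 2 * q v v.
    move: le; rewrite -subr_ge0; congr (0 <= _).
    rewrite normrM exprMn real_normK// rmorphM/= (conj_Creal sR).
    rewrite -[s * _ * _]mulrA [a^* * a]mulrC -normCK rmorphM/= (conj_Creal sR).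
    rewrite rmorphXn/= (conj_Creal (normr_real a)).
    ring.
  by rewrite addrAC subr_ge0.
have v0 := semi_inner_ge0 qP v.
have [v00|vN0] := eqVneq (q v v) 0.
  rewrite v00 mulr0; have [->//|aN0] := eqVneq (`|a| ^+ 2) 0.
  (* The right-hand side of key is constant here: a large s forces a = 0. *)
  have s_ge0 : 0 <= (d + 1) / `|a| ^+ 2.
    by rewrite divr_ge0 ?addr_ge0 ?exprn_ge0.
  have := key _ (ger0_real s_ge0); rewrite v00 mulr0 addr0 -mulrA divfK//.
  have -> : 2 * (d + 1) = d + (d + 2) by ring.
  by rewrite gerDl lt_geF// ltr_wpDl.
have v_gt0 : 0 < q v v by rewrite lt_neqAle eq_sym vN0.
(* The minimum of s^2 |a|^2 q v v - 2 s |a|^2 over s. *)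
have /key : (q v v)^-1 \is Num.real by rewrite realV ger0_real.
have -> : 2 * (q v v)^-1 * `|a| ^+ 2 = `|a| ^+ 2 / q v v + `|a| ^+ 2 / q v v.
  by ring.
have -> : (q v v)^-1 ^+ 2 * `|a| ^+ 2 * q v v = `|a| ^+ 2 / q v v by field.
by rewrite lerD2r ler_pdivrMr.
Qed.

Lemma seminorm_CauchySchwarz u v : `|q u v| <= p u * p v.
Proof.
rewrite -ler_sqr ?nnegrE ?mulr_ge0 ?seminorm_ge0//.
rewrite exprMn !sqr_seminorm.
rewrite near_minimal_orthogonal ?(semi_inner_ge0 qP)// => t.
by rewrite subrr (semi_inner_ge0 qP).
Qed.

End Theory.
End SemiInner.

(** * Contractive extension from a subspace *)

Section Extension.
Context {R : realType}.
Local Notation C := R[i].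
Variables (E H : lmodType C) (K : completeNormedModType C).
Variables (q : E -> E -> C) (j : {linear H -> E}) (A : {linear H -> K}).
Hypothesis qP : semi_inner q.
Hypothesis A_le : forall h, `|A h| <= seminorm q (j h).
Local Notation p := (seminorm q).

(** Approximate orthogonality to the range of j, homogeneous in the test vector.
    Since H need not be complete for q, an exactly orthogonal residue x - j h
    may fail to exist. *)
Definition almost_orthogonal (e : C) (u : E) : Prop :=
  forall k : H, `|q u (j k)| <= e * p (j k).

(** A point of the range of j that is nearest to x up to e^2 will do, by
    [near_minimal_orthogonal]. *)
Lemma almost_projection x (e : C) : 0 < e ->
  exists h, almost_orthogonal e (x - j h).
Proof.
move=> e0; pose S := [set complex.Re (q (x - j h) (x - j h)) | h in [set: H]].
have ReK u : (complex.Re (q u u))%:C%C = q u u.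
  by rewrite RRe_real// ger0_real// (semi_inner_ge0 qP).
have Sinf : has_inf S.
  split; first by exists (complex.Re (q (x - j 0) (x - j 0))), 0.
  exists 0 => _ [h _ <-].
  by rewrite -lecR ReK (semi_inner_ge0 qP).
have e2 : (complex.Re (e ^+ 2))%:C%C = e ^+ 2.
  by rewrite RRe_real// ger0_real// exprn_ge0 ?ltW.
have e2_gt0 : 0 < complex.Re (e ^+ 2) by rewrite -ltcR e2 exprn_gt0.
have [_ [h _ <-] near_inf] := inf_adherent e2_gt0 Sinf.
exists h => k; rewrite -ler_sqr ?nnegrE ?mulr_ge0 ?seminorm_ge0 ?(ltW e0)//.
rewrite exprMn sqr_seminorm; apply: near_minimal_orthogonal => //.
  by apply/exprn_ge0/ltW.
move=> t; set u := x - j h.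
have -> : u - t *: j k = x - j (h + t *: k).
  by rewrite /u linearD [j (t *: k)]linearZ opprD addrA.
rewrite -(ReK u) -e2 -(ReK (x - j _)) -rmorphB lecR lerBlDr.
apply: le_trans (ltW near_inf) _; rewrite lerD2r.
by apply: ge_inf => //; [exact: Sinf.2|exists (h + t *: k)].
Qed.

Lemma almost_orthogonalP a u v e f :
  almost_orthogonal e u -> almost_orthogonal f v ->
  almost_orthogonal (`|a| * e + f) (a *: u + v).
Proof.
move=> ue vf k; rewrite (semi_innerP qP) (le_trans (ler_normD _ _))//.
by rewrite mulrDl lerD// normrM -mulrA ler_wpM2l.
Qed.

(** Up to e, a projection does not increase the seminorm. *)
Lemma almost_projection_le u h e : 0 <= e ->
  almost_orthogonal e (u - j h) -> `|A h| <= p u + e.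
Proof.
move=> e0 ue; apply: le_trans (A_le h) _.
have [->|pN0] := eqVneq (p (j h)) 0; first by rewrite addr_ge0 ?seminorm_ge0.
have p_gt0 : 0 < p (j h) by rewrite lt_neqAle eq_sym pN0 seminorm_ge0.
rewrite -(ler_pM2r p_gt0) -expr2 sqr_seminorm.
have -> : q (j h) (j h) = q u (j h) - q (u - j h) (j h).
  by rewrite (semi_innerBl qP) opprB addrC subrK.
rewrite -[leLHS]ger0_norm; last first.
  by rewrite (semi_innerBl qP) opprB addrC subrK (semi_inner_ge0 qP).
by rewrite mulrDl (le_trans (ler_normB _ _))// lerD ?seminorm_CauchySchwarz.
Qed.

(** Here z stands for the value of A, extended by continuity, at the orthogonal
    projection of x onto the completion of H for q.  Approximate projections
    express this inside H, so that the completion is never formed. *)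
Definition projects (x : E) (z : K) : Prop :=
  forall e, 0 < e ->
  exists2 h, almost_orthogonal e (x - j h) & `|A h - z| <= e.

Lemma projectsP a x y z t :
  projects x z -> projects y t -> projects (a *: x + y) (a *: z + t).
Proof.
move=> xz yt e e0; have a1 : 0 < `|a| + 1 by rewrite ltr_wpDl.
have d0 : 0 < e / (`|a| + 1) by rewrite divr_gt0.
have [h xh hz] := xz _ d0; have [k yk kt] := yt _ d0.
have eE : e = `|a| * (e / (`|a| + 1)) + e / (`|a| + 1).
  by rewrite -[X in _ + X]mul1r -mulrDl mulrCA mulfV ?mulr1// gt_eqF.
exists (a *: h + k).
  rewrite eE linearP opprD addrACA -scalerBr; exact: almost_orthogonalP.
rewrite linearP opprD addrACA -scalerBr.
rewrite (le_trans (ler_normD _ _))// [leRHS]eE lerD// normrZ.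
by rewrite ler_wpM2l.
Qed.

Lemma projects_id h : projects (j h) (A h).
Proof.
move=> e e0; exists h; last by rewrite subrr normr0 ltW.
by move=> k; rewrite subrr (semi_inner0l qP) normr0 mulr_ge0 ?seminorm_ge0 ?ltW.
Qed.

Lemma projects_le x z : projects x z -> `|z| <= p x.
Proof.
move=> xz; apply/ler_addgt0Pr => e e0; have e20 : 0 < e / 2 by rewrite divr_gt0.
have [h xh hz] := xz _ e20.
have := ler_normB (A h) (A h - z); rewrite subKr => /le_trans; apply.
rewrite [e in leRHS]splitr addrA lerD//.
exact: almost_projection_le (ltW _) _.
Qed.

(** By linearity a difference of two values is a value at 0, where the seminorm
    vanishes. *)
Lemma projects_fun x z t : projects x z -> projects x t -> z = t.
Proof.
move=> xz xt; apply/eqP; rewrite -subr_eq0 -normr_le0.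
have := projects_le (projectsP (-1) xt xz).
rewrite !scaleN1r !(addrC (- _)) subrr.
by rewrite /seminorm (semi_inner0l qP) sqrtC0.
Qed.

(** The images under A of the e-approximate projections of x form, as e
    decreases to 0, a Cauchy filter on K. *)
Lemma projects_total x : exists z, projects x z.
Proof.
pose B e := [set A h | h in [set h | almost_orthogonal e (x - j h)]].
pose F := filter_from [set e : C | 0 < e] B.
have monoB e f : e <= f -> B e `<=` B f.
  move=> ef _ [h xh <-]; exists h => // k.
  by rewrite (le_trans (xh k))// ler_wpM2r ?seminorm_ge0.
have closeB e f h k : 0 < e -> 0 < f -> almost_orthogonal e (x - j h) ->
    almost_orthogonal f (x - j k) -> `|A h - A k| <= e + f.
  move=> e0 f0 xh xk.
  have := almost_orthogonalP (-1) xh xk.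
  rewrite scaleN1r opprB subrKA -linearB normrN1 mul1r.
  move=> hk.
  (* k - h is an approximate projection of 0. *)
  have := @almost_projection_le 0 (k - h) (e + f); rewrite /seminorm.
  rewrite sub0r -linearN opprB (semi_inner0l qP) sqrtC0 add0r => /(_ _ hk).
  by rewrite linearB distrC; apply; rewrite ltW ?addr_gt0.
have FF : ProperFilter F.
  apply: filter_from_proper; last first.
    by move=> e /= e0; have [h xh] := almost_projection x e0; exists (A h), h.
  apply: filter_from_filter; first by exists 1 => /=.
  move=> e f /= e0 f0; exists (Num.min e f) => /=.
    by rewrite /Num.min; case: ifP.
  have ef : (e >=< f)%O by rewrite real_comparable// gtr0_real.
  by move=> z zB; split; apply: monoB zB; rewrite comparable_ge_min ?lexx ?orbT.
have /cauchy_cvg/cvg_ex[z Fz] : cauchy F.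
  apply: cauchy_exP => e e0; have e40 : 0 < e / 2 / 2 by rewrite !divr_gt0.
  have [h xh] := almost_projection x e40.
  exists (A h), (e / 2 / 2) => // _ [k xk <-].
  rewrite -ball_normE /=; apply: le_lt_trans (closeB _ _ _ _ e40 e40 xh xk) _.
  by rewrite -splitr [ltRHS]splitr ltrDl divr_gt0.
exists z => e e0.
have [d d0 dB] := Fz _ (nbhsx_ballx z _ e0).
pose m := Num.min e d.
have ed : (e >=< d)%O by rewrite real_comparable// gtr0_real.
have m0 : 0 < m by rewrite /m /Num.min; case: ifP.
have [h xh] := almost_projection x m0; exists h.
  move=> k; rewrite (le_trans (xh k))// ler_wpM2r ?seminorm_ge0//.
  by rewrite comparable_ge_min ?lexx.
have : B d (A h).
  apply: (@monoB m); first by rewrite comparable_ge_min ?lexx ?orbT.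
  by exists h.
by move=> /dB; rewrite -ball_normE /= distrC => /ltW.
Qed.

(** The extension is A composed with the q-orthogonal projection onto (the
    completion of) the range of j. *)
Theorem extend_contraction : exists C : {linear E -> K},
  (forall h, C (j h) = A h) /\ (forall x, `|C x| <= p x).
Proof.
have [f fP] := choice projects_total.
have f_lin : linear f.
  by move=> a x y; apply: projects_fun (fP _) (projectsP _ (fP _) (fP _)).
pose fL := GRing.isLinear.Build _ _ _ _ f f_lin.
pose L : {linear E -> K} := HB.pack f fL.
exists L; split=> [h|x]; last exact: projects_le (fP x).
exact: projects_fun (fP _) (projects_id h).
Qed.

End Extension.

(** * Banach limits *)

Definition bounded_seq (K : numDomainType) (u : nat -> K) : Prop :=
  exists M : K, forall n, `|u n| <= M.

Record banach_limit (K : numDomainType) (L : (nat -> K) -> K) : Prop := {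
  banach_limitP : forall a u v, bounded_seq u -> bounded_seq v ->
    L (fun n => a * u n + v n) = a * L u + L v;
  banach_limit_cst : forall a, L (fun _ => a) = a;
  banach_limit_shift : forall u, bounded_seq u -> L (fun n => u n.+1) = L u;
  banach_limit_le : forall u (M : K), (forall n, `|u n| <= M) -> `|L u| <= M }.

Lemma bounded_seqP (K : numDomainType) (a : K) (u v : nat -> K) :
  bounded_seq u -> bounded_seq v ->
  bounded_seq (fun n => a * u n + v n).
Proof.
move=> [M uM] [N vN]; exists (`|a| * M + N) => n.
by rewrite (le_trans (ler_normD _ _))// normrM lerD// ler_wpM2l.
Qed.

Section BanachLimit.
Context {R : realType}.

Let mean (u : nat -> R) (n : nat) : R := (\sum_(k < n.+1) u k) / n.+1%:R.

Let meanP a u v n : mean (fun k => a * u k + v k) n = a * mean u n + mean v n.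
Proof. by rewrite /mean big_split/= -mulr_sumr mulrDl mulrA. Qed.

Let mean_cst a n : mean (fun _ => a) n = a.
Proof.
by rewrite /mean sumr_const card_ord -[a *+ _]mulr_natr mulfK// pnatr_eq0.
Qed.

Let mean_le u (M : R) : (forall n, `|u n| <= M) -> forall n, `|mean u n| <= M.
Proof.
move=> uM n; rewrite /mean normf_div normr_nat ler_pdivrMr// mulr_natr.
rewrite (le_trans (ler_norm_sum _ _ _))// -[X in _ *+ X]card_ord -sumr_const.
exact: ler_sum.
Qed.

(** The difference of the means telescopes to (u (n + 1) - u 0) / (n + 1). *)
Let mean_shift u : bounded_seq u ->
  mean (fun n => u n.+1) n - mean u n @[n --> \oo] --> (0 : R).
Proof.
move=> [M uM].
have -> : (fun n => mean (fun n => u n.+1) n - mean u n) =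
    (fun n => (u n.+1 - u 0) * harmonic n).
  apply/funext => n; rewrite /mean -mulrBl; congr (_ * _).
  rewrite big_ord_recr/= [in X in _ - X]big_ord_recl/=.
  by rewrite addrC opprD addrACA subrr addr0 addrC.
have h0 : (M + M) * harmonic n @[n --> \oo] --> (0 : R).
  rewrite -(mulr0 (M + M)); apply: cvgM; [exact: cvg_cst|exact: cvg_harmonic].
apply: norm_cvg0; apply: squeeze_cvgr h0; last exact: cvg_cst.
apply: nearW => n; rewrite normr_ge0/= normrM.
rewrite [ `|harmonic n|]ger0_norm ?harmonic_ge0//.
by rewrite ler_wpM2r ?harmonic_ge0// (le_trans (ler_normB _ _))// lerD.
Qed.

Let ultra_cvg (U : set_system nat) (u : nat -> R) : UltraFilter U ->
  bounded_seq u -> cvg (u @ U).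
Proof.
move=> UU [M uM]; have uU : (u @ U) [set` `[- M, M]].
  by apply: (@filterE _ U) => n; rewrite /= in_itv/= -ler_norml.
have [] := segment_compact _ uU.
move=> z [_ zU]; apply/cvg_ex; exists z => B Bz.
have [//|UB] := in_ultra_setVsetC (u @^-1` B) UU.
by have [t []] := zU (~` B) B UB Bz.
Qed.

(** The limit of the arithmetic means along a free ultrafilter: averaging makes
    the limit invariant under the shift, the ultrafilter makes it exist. *)
Lemma real_banach_limit : exists L : (nat -> R) -> R, banach_limit L.
Proof.
have [U [UU ooU]] := ultraFilterLemma (F := \oo) _.
have cv u : bounded_seq u -> cvg (mean u @ U).
  by move=> [M uM]; apply: ultra_cvg; exists M => n; exact: mean_le.
exists (fun u => lim (mean u @ U)); split.
- move=> a u v bu bv; apply: cvg_lim => //.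
  rewrite (_ : mean _ = fun n => a * mean u n + mean v n).
    apply: cvgD; last exact: cv.
    apply: cvgM; [exact: cvg_cst|exact: cv].
  by apply/funext => n; rewrite meanP.
- move=> a; apply: cvg_lim => //.
  rewrite (_ : mean _ = fun=> a); first exact: cvg_cst.
  by apply/funext => n; rewrite mean_cst.
- move=> u bu; apply: cvg_lim => //.
  rewrite (_ : mean _ =
      fun n => (mean (fun n => u n.+1) n - mean u n) + mean u n).
    rewrite -[X in _ --> X]add0r; apply: cvgD; last exact: cv.
    by apply: cvg_trans (mean_shift bu); apply: cvg_app.
  by apply/funext => n; rewrite subrK.
- move=> u M uM; have cu : cvg (mean u @ U) by apply: cv; exists M.
  have mM := mean_le uM.
  rewrite ler_norml limr_ge ?limr_le//; apply: nearW => n;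
    by have := mM n; rewrite ler_norml => /andP[].
Qed.

(** Applied to real and imaginary parts, a real Banach limit gives a complex
    linear functional.  The bound by M, with no extra constant, follows by
    rotating the limit onto the positive real axis. *)
Lemma complex_banach_limit : exists L : (nat -> R[i]) -> R[i], banach_limit L.
Proof.
have [L LP] := real_banach_limit.
pose Lc (u : nat -> R[i]) : R[i] :=
  Complex (L (fun n => complex.Re (u n))) (L (fun n => complex.Im (u n))).
have ReM (x M : R[i]) : `|x| <= M -> `|complex.Re x| <= complex.Re M.
  move=> xM; have M0 := le_trans (normr_ge0 _) xM.
  rewrite -lecR (le_trans (normc_ge_Re x))// (le_trans xM)//.
  by rewrite RRe_real// ger0_real.
have ImM (x M : R[i]) : `|x| <= M -> `|complex.Im x| <= complex.Re M.
  move=> xM; rewrite -normrN -ReiNIm; apply: ReM.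
  by rewrite normrM complexiE normCi mulr1.
have bRe (u : nat -> R[i]) : bounded_seq u ->
    bounded_seq (fun n => complex.Re (u n)).
  by move=> [M uM]; exists (complex.Re M) => n; exact: (ReM _ _ (uM n)).
have bIm (u : nat -> R[i]) : bounded_seq u ->
    bounded_seq (fun n => complex.Im (u n)).
  by move=> [M uM]; exists (complex.Re M) => n; exact: (ImM _ _ (uM n)).
have LcP a (u v : nat -> R[i]) : bounded_seq u -> bounded_seq v ->
    Lc (fun n => a * u n + v n) = a * Lc u + Lc v.
  move=> bu bv.
  have bRu := bRe _ bu; have bIu := bIm _ bu.
  have bRv := bRe _ bv; have bIv := bIm _ bv.
  have LP2 x y f g h : bounded_seq f -> bounded_seq g -> bounded_seq h ->
      L (fun n => x * f n + (y * g n + h n)) = x * L f + (y * L g + L h).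
    move=> bf bg bh; rewrite -(banach_limitP LP)//.
    by rewrite -(banach_limitP LP)//; exact: bounded_seqP.
  case: a => a b; rewrite /Lc; apply/eqP; rewrite eq_complex/=.
  apply/andP; split; apply/eqP.
    rewrite -mulNr -addrA -LP2//; congr L; apply/funext => n.
    by case: (u n) (v n) => [x y] [x' y'] /=; rewrite mulNr addrA.
  rewrite -addrA -LP2//; congr L; apply/funext => n.
  by case: (u n) (v n) => [x y] [x' y'] /=; rewrite addrA.
have Lc_cst a : Lc (fun=> a) = a.
  by case: a => a b; rewrite /Lc/= !(banach_limit_cst LP).
exists Lc; split=> //.
- move=> u bu; rewrite /Lc (banach_limit_shift LP (bRe _ bu)).
  by rewrite (banach_limit_shift LP (bIm _ bu)).
- move=> u M uM; have bu : bounded_seq u by exists M.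
  have M0 : 0 <= M by exact: le_trans (normr_ge0 _) (uM 0).
  have [->|LN0] := eqVneq (Lc u) 0; first by rewrite normr0.
  pose w := (Lc u)^* / `|Lc u|.
  have w1 : `|w| = 1 by rewrite normf_div norm_conjC normr_id divff// normr_eq0.
  have wL : Lc (fun n => w * u n) = `|Lc u|.
    have b0 : bounded_seq (fun=> 0 : R[i]) by exists 0 => n; rewrite normr0.
    have -> : Lc (fun n => w * u n) = w * Lc u.
      have := LcP w u _ bu b0; rewrite Lc_cst addr0 => <-.
      by congr Lc; apply/funext => n; rewrite addr0.
    by rewrite /w mulrAC [_ * Lc u]mulrC -normCK expr2 mulfK// normr_eq0//.
  rewrite -[M]RRe_real ?ger0_real// -[leLHS]RRe_real ?normr_real// lecR.
  rewrite (le_trans (ler_norm _))// -wL.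
  by apply: (banach_limit_le LP) => n; rewrite ReM// normrM w1 mul1r.
Qed.

End BanachLimit.

(** * Bounded forms and operators on Hilbert spaces *)

Section Operators.
Context {R : realType}.
Local Notation C := R[i].

Lemma semi_inner_inner (U : hilbertType R) : semi_inner (@inner R U).
Proof.
split=> [a x y z|x y|x].
- by rewrite linearPl.
- by rewrite hermC expr0 mul1r.
- by rewrite -normr_inner exprn_ge0.
Qed.

Lemma seminorm_inner (U : hilbertType R) (x : U) :
  seminorm (@inner R U) x = `|x|.
Proof. by rewrite /seminorm -normr_inner sqrCK. Qed.

Lemma inner_inj (U : hilbertType R) (x y : U) :
  (forall z, inner x z = inner y z) -> x = y.
Proof.
move=> xy; apply/eqP; rewrite -subr_eq0 -normr_eq0 -sqrf_eq0 normr_inner.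
by rewrite linearBl/= xy subrr.
Qed.

Lemma semi_innerZ (E : lmodType C) (q : E -> E -> C) (c : C) : 0 <= c ->
  semi_inner q -> semi_inner (fun x y => c * q x y).
Proof.
move=> c0 qP; split=> [a x y z|x y|x].
- by rewrite (semi_innerP qP) mulrDr mulrCA.
- by rewrite (semi_innerC qP) rmorphM/= (conj_Creal (ger0_real c0)).
- by rewrite mulr_ge0 ?(semi_inner_ge0 qP).
Qed.

Lemma semi_inner_defect (E : lmodType C) (q : E -> E -> C) (V : hilbertType R)
    (B : {linear E -> V}) :
  semi_inner q -> (forall x, `|B x| <= seminorm q x) ->
  semi_inner (fun x y => q x y - inner (B x) (B y)).
Proof.
move=> qP B_le; split=> [a x y z|x y|x].
- by rewrite (semi_innerP qP) linearP linearPl; ring.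
- by rewrite (semi_innerC qP) [inner _ _]hermC expr0 mul1r rmorphB.
- rewrite subr_ge0 -normr_inner -sqr_seminorm.
  by rewrite ler_sqr ?nnegrE ?seminorm_ge0.
Qed.

Lemma seminorm_sqrZ_inner (U : hilbertType R) (c : C) (x : U) : 0 <= c ->
  seminorm (fun x y : U => c ^+ 2 * inner x y) x = c * `|x|.
Proof.
by move=> c0; rewrite /seminorm -normr_inner -exprMn sqrCK// mulr_ge0.
Qed.

Section FormOperator.
Variables (U V : hilbertType R) (b : U -> V -> C) (c : C).
Hypothesis bPl : forall a x x' y, b (a *: x + x') y = a * b x y + b x' y.
Hypothesis bPr : forall a x y y', b x (a *: y + y') = a^* * b x y + b x y'.
Hypothesis c_ge0 : 0 <= c.
Hypothesis b_le : forall x y, `|b x y| <= c * `|x| * `|y|.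

Let b0r x : b x 0 = 0.
Proof.
by apply/eqP; rewrite -normr_le0 (le_trans (b_le _ _))// normr0 mulr0.
Qed.

Let b0l y : b 0 y = 0.
Proof.
by apply/eqP; rewrite -normr_le0 (le_trans (b_le _ _))// normr0 mulr0 mul0r.
Qed.

(** The block form with diagonal c^2 and 1 and with b off the diagonal; it is
    positive exactly because b is bounded by c. *)
Let q (u v : U * V) : C :=
  c ^+ 2 * inner u.1 v.1 + (b u.1 v.2 + (b v.1 u.2)^*) + inner u.2 v.2.

Let qP : semi_inner q.
Proof.
split=> [a x y z|x y|x]; rewrite /q/=.
- by rewrite bPl bPr !linearPl rmorphD rmorphM/= conjCK; ring.
- rewrite !rmorphD rmorphM/= conjCK.
  rewrite (conj_Creal (ger0_real (exprn_ge0 2 c_ge0))).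
  rewrite [inner x.1 _]hermC [inner x.2 _]hermC !expr0 !mul1r.
  by ring.
- rewrite -!normr_inner.
  set t := b _ _; have tle : `|t + t^*| <= 2 * (c * `|x.1| * `|x.2|).
    rewrite (le_trans (ler_normD _ _))// norm_conjC mulr_natl mulr2n.
    by rewrite lerD ?b_le.
  have tR : t + t^* \is Num.real by rewrite CrealE rmorphD/= conjCK addrC.
  have := tle; rewrite real_ler_norml// => /andP[tge _].
  rewrite addrAC -lerBlDl sub0r; apply: le_trans (tge).
  rewrite lerN2 -subr_ge0 -exprMn.
  have -> : (c * `|x.1|) ^+ 2 + `|x.2| ^+ 2 - 2 * (c * `|x.1| * `|x.2|) =
      (c * `|x.1| - `|x.2|) ^+ 2 by ring.
  by rewrite -real_normK ?exprn_ge0// realB ?ger0_real// ?mulr_ge0.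
Qed.

(** On the second summand q is the inner product of V, so that the identity of V
    extends to a q-contraction T of the whole sum: in effect T is the projection
    onto V orthogonal for q, and T (x, 0) is the vector that represents b x. *)
Lemma form_operator : exists Y : {linear U -> V},
  (forall x, `|Y x| <= c * `|x|) /\ (forall x y, inner (Y x) y = b x y).
Proof.
have j_lin : linear (fun y : V => (0, y) : U * V).
  by move=> a x y; congr pair; rewrite /= scaler0 addr0.
pose j : {linear V -> (U * V)%type} := HB.pack (fun y : V => (0, y) : U * V)
  (GRing.isLinear.Build _ _ _ _ (fun y : V => (0, y) : U * V) j_lin).
have k_lin : linear (fun x : U => (x, 0) : U * V).
  by move=> a x y; congr pair; rewrite /= scaler0 addr0.
pose k : {linear U -> (U * V)%type} := HB.pack (fun x : U => (x, 0) : U * V)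
  (GRing.isLinear.Build _ _ _ _ (fun x : U => (x, 0) : U * V) k_lin).
have qj y : q (j y) (j y) = `|y| ^+ 2.
  by rewrite /q/= linear0l b0l conjC0 mulr0 !addr0 !add0r -normr_inner.
have qk x : q (k x) (k x) = (c * `|x|) ^+ 2.
  by rewrite /q/= linear0l b0r conjC0 !addr0 -normr_inner exprMn.
have id_le y : `|(idfun : {linear V -> V}) y| <= seminorm q (j y).
  by rewrite /seminorm qj sqrCK.
have [T [Tj T_le]] := extend_contraction qP id_le.
exists (T \o k : {linear U -> V}); split=> [x|x y] /=.
  by rewrite (le_trans (T_le _))// /seminorm qk sqrCK// mulr_ge0.
(* The defect form of T vanishes at j y, hence also against j y. *)
have rP := semi_inner_defect qP T_le.
have := seminorm_CauchySchwarz rP (k x) (j y).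
rewrite [seminorm _ (j y)]/seminorm qj Tj/= -normr_inner subrr sqrtC0 mulr0.
rewrite normr_le0 subr_eq0 => /eqP <-.
by rewrite /q/= linear0l linear0r b0r conjC0 mulr0 add0r !addr0.
Qed.

End FormOperator.
End Operators.

(** * Lifting an intertwining relation *)

Section Lifting.
Context {R : realType}.
Local Notation C := R[i].

(** Vs V is the orthogonal projection onto the orthogonal complement of the
    kernel of V, and V is isometric there. *)
Lemma sqr_norm_coisometry (K L : hilbertType R) (V : {linear K -> L})
    (Vs : {linear L -> K}) :
    (forall x y, inner (V x) y = inner x (Vs y)) -> cancel Vs V ->
  forall w, `|w| ^+ 2 = `|V w| ^+ 2 + `|w - Vs (V w)| ^+ 2.
Proof.
move=> adj VsK w; have adjC x y : inner (Vs x) y = inner x (V y).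
  rewrite (semi_innerC (semi_inner_inner K)) -adj.
  by rewrite -(semi_innerC (semi_inner_inner L)).
rewrite !normr_inner linearBl !linearBr/= !adjC -!adj VsK.
by ring.
Qed.

Section Step.
Variables (H : lmodType C) (U K L : hilbertType R).
Variables (j : {linear H -> U}) (A : {linear H -> K}) (B : {linear U -> L}).
Variables (V : {linear K -> L}) (Vs : {linear L -> K}) (c : C).
Hypothesis adj : forall x y, inner (V x) y = inner x (Vs y).
Hypothesis VsK : cancel Vs V.
Hypothesis c_ge0 : 0 <= c.
Hypothesis A_le : forall h, `|A h| <= c * `|j h|.
Hypothesis B_le : forall x, `|B x| <= c * `|x|.
Hypothesis VA : forall h, V (A h) = B (j h).

(** The condition V Y = B prescribes the component of Y orthogonal to the kernel
    of V, namely Vs B.  The other component is prescribed only on H, and it must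
    be a contraction for the defect form c^2 <x, y> - <Bx, By>.  On H it is one,
    by [sqr_norm_coisometry], and [extend_contraction] does the rest. *)
Lemma contractive_completion : exists Y : {linear U -> K},
  [/\ forall h, Y (j h) = A h, forall x, V (Y x) = B x
    & forall x, `|Y x| <= c * `|x|].
Proof.
pose kerV (w : K) := w - Vs (V w).
have VkerV w : V (kerV w) = 0 by rewrite linearB VsK subrr.
have sqr := sqr_norm_coisometry adj VsK.
pose qc (x y : U) : C := c ^+ 2 * inner x y.
have qcP : semi_inner qc.
  by apply: semi_innerZ (semi_inner_inner U); rewrite exprn_ge0.
have B_le' x : `|B x| <= seminorm qc x by rewrite seminorm_sqrZ_inner.
pose q x y := qc x y - inner (B x) (B y).
have qP : semi_inner q by exact: semi_inner_defect.
have q_sqr x : q x x = (c * `|x|) ^+ 2 - `|B x| ^+ 2.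
  by rewrite /q /qc -!normr_inner exprMn.
pose D : {linear H -> K} := A \- (Vs \o V \o A).
have D_le h : `|D h| <= seminorm q (j h).
  rewrite -ler_sqr ?nnegrE ?seminorm_ge0// sqr_seminorm q_sqr -VA lerBrDl.
  by rewrite -sqr ler_sqr ?nnegrE ?mulr_ge0.
have [G [Gj G_le]] := extend_contraction qP D_le.
(* The values of G need not lie in the kernel of V, and are projected there. *)
pose Y : {linear U -> K} := (Vs \o B) \+ (G \- (Vs \o V \o G)).
have VY x : V (Y x) = B x by rewrite linearD /= VsK [V (_ - _)]VkerV addr0.
exists Y; split=> [h|//|x].
  by rewrite /Y/= Gj /D/= [V (_ - _)]VkerV linear0 subr0 -VA addrC subrK.
rewrite -ler_sqr ?nnegrE ?mulr_ge0// sqr VY.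
have -> : Y x - Vs (B x) = kerV (G x) by rewrite /Y/= addrAC subrr add0r.
rewrite -lerBrDl -q_sqr -sqr_seminorm; apply: le_trans (_ : `|G x| ^+ 2 <= _).
  by rewrite [leRHS]sqr lerDr exprn_ge0.
by rewrite ler_sqr ?nnegrE ?seminorm_ge0.
Qed.

End Step.

Section Commutant.
Variables (H : lmodType C) (U K : hilbertType R).
Variables (j : {linear H -> U}) (A : {linear H -> K}) (S : H -> H).
Variables (W : {linear U -> U}) (V Vs : {linear K -> K}) (c : C).
Hypothesis adj : forall x y, inner (V x) y = inner x (Vs y).
Hypothesis VsK : cancel Vs V.
Hypothesis c_ge0 : 0 <= c.
Hypothesis A_le : forall h, `|A h| <= c * `|j h|.
Hypothesis W_le : forall x, `|W x| <= `|x|.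
Hypothesis Wj : forall h, W (j h) = j (S h).
Hypothesis VA : forall h, V (A h) = A (S h).

(** V Y = Y W says that Y is a fixed point of the relation V Y' = Y W, which is
    linear in the pair (Y, Y') and is considered on a convex weakly compact set.
    As for Markov and Kakutani, averaging an orbit gives a fixed point; a Banach
    limit performs the averaging and the passage to the limit at once. *)
Theorem intertwining_lifting : exists Y : {linear U -> K},
  [/\ forall h, Y (j h) = A h, forall x, V (Y x) = Y (W x)
    & forall x, `|Y x| <= c * `|x|].
Proof.
pose P (Y : {linear U -> K}) :=
  (forall h, Y (j h) = A h) /\ (forall x, `|Y x| <= c * `|x|).
have [Y0 Y0P] : exists Y0, P Y0.
  have qcP : semi_inner (fun x y : U => c ^+ 2 * inner x y).
    by apply: semi_innerZ (semi_inner_inner U); rewrite exprn_ge0.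
  have [h|T [Tj T_le]] := extend_contraction (j := j) (A := A) qcP.
    by rewrite seminorm_sqrZ_inner.
  by exists T; split=> // x; rewrite -seminorm_sqrZ_inner.
have /choice[f fP] (Y : {linear U -> K}) :
    exists Y' : {linear U -> K}, P Y -> P Y' /\ (forall x, V (Y' x) = Y (W x)).
  have [[Yj Y_le]|nPY] := pselect (P Y); last by exists Y.
  have [|h|Y' [Y'j VY' Y'_le]] :=
    @contractive_completion _ _ _ _ j A (Y \o W) V Vs c adj VsK c_ge0 A_le.
  - by move=> x /=; rewrite (le_trans (Y_le _))// ler_wpM2l.
  - by rewrite /= Wj Yj VA.
  - by exists Y'.
pose Z n := iter n f Y0.
have ZP n : P (Z n) by elim: n => // n IHn; have [] := fP _ IHn.
have VZ n x : V (Z n.+1 x) = Z n (W x) by have [_] := fP _ (ZP n).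
have [Lim LimP] := @complex_banach_limit R.
pose b x y := Lim (fun n => inner (Z n x) y).
have Z_le x y n : `|inner (Z n x) y| <= c * `|x| * `|y|.
  have := seminorm_CauchySchwarz (semi_inner_inner K) (Z n x) y.
  rewrite !seminorm_inner => /le_trans; apply.
  by rewrite ler_wpM2r// (ZP n).2.
have Zb x y : bounded_seq (fun n => inner (Z n x) y).
  by exists (c * `|x| * `|y|); exact: Z_le.
have [Y [Y_le YE]] : exists Y : {linear U -> K},
    (forall x, `|Y x| <= c * `|x|) /\ (forall x y, inner (Y x) y = b x y).
  apply: form_operator => // [a x x' y|a x y y'|x y].
  - rewrite /b -(banach_limitP LimP)//; congr Lim; apply/funext => n.
    by rewrite linearP linearPl.
  - rewrite /b -(banach_limitP LimP)//; congr Lim; apply/funext => n.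
    by rewrite linearPr.
  - exact: (banach_limit_le LimP (Z_le x y)).
exists Y; split=> // [h|x]; apply: inner_inj => z.
  rewrite YE /b -[RHS](banach_limit_cst LimP); congr Lim; apply/funext => n.
  by rewrite (ZP n).1.
rewrite adj !YE /b -(banach_limit_shift LimP (Zb _ _)); congr Lim.
by apply/funext => n; rewrite -adj VZ.
Qed.

End Commutant.
End Lifting.

(** * Operator norms *)

Section OperatorNorm.
Context {R : realType}.
Variables (U V : normedModType R[i]).

Let ball_image (f : U -> V) : set R :=
  [set complex.Re `|f x| | x in [set x : U | `|x| <= 1]].

Let ReK (x : V) : (complex.Re `|x|)%:C%C = `|x|.
Proof. by rewrite RRe_real ?normr_real. Qed.

Lemma opnorm_le (f : U -> V) (c : R) : 0 <= c ->
  (forall x, `|f x| <= c%:C%C * `|x|) -> opnorm f <= c.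
Proof.
move=> c0 f_le; apply: ge_sup.
  by exists (complex.Re `|f 0|), 0 => //=; rewrite normr0.
move=> _ [x /= x1 <-]; rewrite -lecR ReK (le_trans (f_le x))//.
by rewrite ler_piMr// ler0c.
Qed.

Lemma le_opnorm (f : {linear U -> V}) : bounded_near f (nbhs (0 : U)) ->
  0 <= opnorm f /\ forall x, `|f x| <= (opnorm f)%:C%C * `|x|.
Proof.
move=> /linear_boundedP/pinfty_ex_gt0[M M0 f_le].
have ubM : ubound (ball_image f) (complex.Re M).
  move=> _ [x /= x1 <-]; rewrite -lecR ReK RRe_real ?gtr0_real//.
  by rewrite (le_trans (f_le x))// ler_piMr// ltW.
have sup_ge x : `|x| <= 1 -> `|f x| <= (opnorm f)%:C%C.
  move=> x1; rewrite -ReK lecR.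
  apply: ub_le_sup; first by exists (complex.Re M).
  by exists x.
split=> [|x].
  by rewrite -ler0c (le_trans (normr_ge0 (f 0)))// sup_ge// normr0.
have [->|x0] := eqVneq x 0; first by rewrite linear0 !normr0 mulr0.
have nx : 0 < `|x| by rewrite normr_gt0.
rewrite -ler_pdivrMr// mulrC -[ `|x|^-1]ger0_norm ?invr_ge0// -normrZ -linearZ.
by rewrite sup_ge// normrZ normfV normr_id mulVf// gt_eqF.
Qed.

Lemma bounded_near_linear (f : {linear U -> V}) (c : R[i]) : 0 <= c ->
  (forall x, `|f x| <= c * `|x|) -> bounded_near f (nbhs (0 : U)).
Proof.
move=> c0 f_le; apply/linear_boundedP; near=> r => x.
rewrite (le_trans (f_le x))// ler_wpM2r//.
by near: r; apply: nbhs_pinfty_ge; rewrite ger0_real.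
Unshelve. all: by end_near. Qed.

End OperatorNorm.

Theorem theorem6p4 (R : realType) (H K1 K2 : hilbertType R)
    (i1 : {linear H -> K1}) (i2 : {linear H -> K2})
    (Q T1 T2 X : {bounded H -> H})
    (V1 : {bounded K1 -> K1}) (V2 Qbar : {bounded K2 -> K2}) :
  is_inclusion i1 -> is_inclusion i2 ->
  contractive T1 -> contractive T2 -> contractive (Q \o T2) ->
  T1 \o X =1 X \o Q \o T2 ->
  co_isometric_extension i1 T1 V1 ->
  co_isometric_extension i2 T2 V2 ->
  is_extension i2 i2 Q Qbar ->
  contractive (Qbar \o V2) ->
  exists Y : {bounded K2 -> K1},
    norm_preserving_extension i2 i1 X Y /\
    V1 \o Y =1 Y \o Qbar \o V2.
Proof.
move=> i1_isom i2_isom _ _ _ TX [V1i1 [Vs adj VsK]] [V2i2 _] Qi2 QV_le.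
have i_norm (K : hilbertType R) (i : {linear H -> K}) : is_inclusion i ->
    forall h, `|i h| = `|h|.
  move=> i_isom h; apply/eqP; rewrite -(@eqrXn2 _ 2)//.
  by rewrite !normr_inner i_isom.
have b_le (U V : hilbertType R) (f : {bounded U -> V}) :=
  le_opnorm (@bounded_linear_subproof _ _ _ f).
pose W : {linear K2 -> K2} := Qbar \o V2.
have W_le x : `|W x| <= `|x|.
  have [_ /(_ x)/le_trans] :
      0 <= opnorm W /\ forall x, `|W x| <= (opnorm W)%:C%C * `|x|.
    have c_ge0 : 0 <= (opnorm Qbar)%:C%C * (opnorm V2)%:C%C.
      by rewrite mulr_ge0// ler0c (b_le _ _ _).1.
    apply: le_opnorm; apply: bounded_near_linear c_ge0 _ => y.
    rewrite /W/=; apply: le_trans ((b_le _ _ Qbar).2 _) _.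
    rewrite -[X in _ <= X]mulrA; apply: ler_wpM2l; last exact: (b_le _ _ V2).2.
    by rewrite ler0c (b_le _ _ Qbar).1.
  apply; rewrite -[leRHS]mul1r ler_wpM2r//.
  by rewrite -[1](rmorph1 (real_complex R)) lecR.
have [X_ge0 X_le] := b_le _ _ X.
have Xc_ge0 : 0 <= (opnorm X)%:C%C by rewrite ler0c.
have [h|h|h|Y [Yi2 VY Y_le]] :=
  intertwining_lifting (j := i2) (A := i1 \o X) (S := Q \o T2) (W := W)
    (c := (opnorm X)%:C%C) adj VsK Xc_ge0 _ W_le.
- by rewrite /= (i_norm _ _ i1_isom) (i_norm _ _ i2_isom); exact: X_le.
- by rewrite /= -Qi2 -V2i2.
- by rewrite /= V1i1; exact: (congr1 i1 (TX h)).
pose Yb : {bounded K2 -> K1} := HB.pack (Y : K2 -> K1)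
  (GRing.isLinear.Build _ _ _ _ (Y : K2 -> K1) (linearP Y))
  (isBoundedLinear.Build _ _ _ (Y : K2 -> K1)
    (bounded_near_linear Xc_ge0 Y_le)).
exists Yb; split=> //; split=> //.
apply/eqP; rewrite eq_le; apply/andP; split; first exact: opnorm_le.
have [Yb_ge0 Yb_le] := b_le _ _ Yb.
apply: opnorm_le => // h.
rewrite -(i_norm _ _ i1_isom) -(i_norm _ _ i2_isom).
by have -> : i1 (X h) = Y (i2 h); [rewrite Yi2|exact: Yb_le].
Qed.
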